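(* Let $\mathbf w=(w_1,\ldots,w_L)^\top$ be a positive probability vector satisfying $$\sum_{j\ne l}w_j>w_l\quad\text{for all } l\in\{1,\ldots,L\}.$$ Let $\hat F$ be equal either to $F$ or to $F+(1/\bar p_l)\mathbf v\mathbf e_l^\top$ for some $l\in\{1,\ldots,L\}$. Then there is a vector $\boldsymbol\gamma^\star=(\gamma_1^\star,\ldots,\gamma_L^\star)^\top>\mathbf 0$ such that, with $A^\star=\mathrm{diag}(\boldsymbol\gamma^\star)\hat F$, $\rho(A^\star)=1$ and $\mathbf x(A^\star)\circ\mathbf y(A^\star)=\mathbf w$, and $$\max_{\boldsymbol\gamma=(\gamma_1,\ldots,\gamma_L)^\top>\mathbf 0,\ \rho(\mathrm{diag}(\boldsymbol\gamma)\hat F)\le1}\ \sum_{l=1}^L w_l\log\gamma_l=\sum_{l=1}^L w_l\log\gamma_l^\star.$$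
   Context: $F=[f_{ij}]\in\mathbb R^{L\times L}$ is a fixed matrix with zero diagonal entries and positive off-diagonal entries, and $\mathbf v,\bar{\mathbf p}\in\mathbb R^L$ are fixed vectors with all entries positive; $\mathbf e_l$ is the $l$-th standard basis vector. For an irreducible nonnegative matrix $A$, $\rho(A)$ is its spectral radius (Perron-Frobenius eigenvalue), and $\mathbf x(A),\mathbf y(A)>\mathbf 0$ are right and left Perron eigenvectors ($A\mathbf x=\rho(A)\mathbf x$, $\mathbf y^\top A=\rho(A)\mathbf y^\top$) normalized so that $\mathbf x(A)\circ\mathbf y(A)$ is a probability vector; $\circ$ is the entrywise product. The vector $\mathbf x(A)\circ\mathbf y(A)$ is then uniquely determined. A probability vector is a nonnegative vector with entries summing to $1$; $\boldsymbol\gamma>\mathbf 0$ means all entries are positive. *)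

(* Defs.v *)
From HB Require Import structures.
From mathcomp Require Import all_boot all_order all_algebra.
From mathcomp Require Import complex.
From mathcomp Require Import all_classical all_reals all_analysis.

Set Implicit Arguments.
Unset Strict Implicit.
Unset Printing Implicit Defensive.

Import Order.TTheory GRing.Theory Num.Theory.

Local Open Scope classical_set_scope.
Local Open Scope ring_scope.

Section PerronFrobenius.
Variables (R : realType) (L : nat).
Implicit Types (A : 'M[R]_L) (x y w g : 'cV[R]_L).

Definition pos_vec x : Prop := forall l, 0 < x l 0.

Definition prob_vec w : Prop := (forall l, 0 <= w l 0) /\ \sum_l w l 0 = 1.

Definition hadamard x y : 'cV[R]_L := \col_l (x l 0 * y l 0).

Definition std_basis (l : 'I_L) : 'cV[R]_L := delta_mx l 0.

(* The eigenvalues are those of A over the complex field R[i]; the set of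
   their moduli is finite, and nonempty when 0 < L, so the sup is a max. *)
Definition spectral_radius A : R :=
  sup [set ComplexField.Normc.normc z | z in
        [set z : R[i] | eigenvalue (map_mx (real_complex R) A) z]].

Definition perron_pair A x y : Prop :=
  [/\ pos_vec x, pos_vec y,
      A *m x = spectral_radius A *: x,
      y^T *m A = spectral_radius A *: y^T &
      prob_vec (hadamard x y)].

(* "x(A) o y(A) = w": normalized Perron eigenvectors exist, and whichever are
   chosen (they are unique up to x -> c x, y -> y / c when A is irreducible)
   their entrywise product is w. *)
Definition perron_product A w : Prop :=
  (exists x y, perron_pair A x y) /\
  (forall x y, perron_pair A x y -> hadamard x y = w).

Definition diag_scale g A : 'M[R]_L := diag_mx g^T *m A.

Definition weighted_log w g : R := \sum_l w l 0 * ln (g l 0).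

Definition is_max (S : set R) (m : R) : Prop := S m /\ ubound S m.

End PerronFrobenius.

(* Main.v *)
Require Import Defs.
From HB Require Import structures.
From mathcomp Require Import all_boot all_order all_algebra.
From mathcomp Require Import complex.
From mathcomp Require Import all_classical all_reals all_analysis.
From mathcomp Require Import ring lra.

Set Implicit Arguments.
Unset Strict Implicit.
Unset Printing Implicit Defensive.

Import Order.TTheory GRing.Theory Num.Theory.
Import numFieldNormedType.Exports.

Local Open Scope classical_set_scope.
Local Open Scope ring_scope.

(** The idea is to characterize the optimal scaling variationally.  For
    [x > 0] put [phi(x) = sum_i w_i ln ((Fhat x)_i / x_i)], which is invariant
    under [x -> c x].

    The condition [w_l < sum_(j != l) w_j] makes [phi] coercive on the rays of
    the open positive orthant ([mean_log_ratio_coercive]): if the largest entry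
    [x_k] is 1, then among the numerators only [(Fhat x)_k] may be small,
    because the off-diagonal entries of [Fhat] are positive, and it is small
    only if all [x_j] with [j != k] are; its weight [w_k] is then beaten by the
    total weight of these denominators.  Hence [phi] has a global minimizer [x]
    ([mean_log_ratio_has_min]).  Stationarity at [x] reads
    [sum_i w_i / (Fhat x)_i * Fhat_ij = w_j / x_j]
    ([mean_log_ratio_stationary]).  With [gamma_i = x_i / (Fhat x)_i] and
    [y_i = w_i / x_i] this says exactly that [x] and [y] are right and left
    eigenvectors of [diag(gamma) Fhat] for the eigenvalue 1, and [x o y = w]
    by construction ([scaled_perron]).  Moreover
    [sum_i w_i ln gamma_i = - phi(x)].

    For optimality, let [rho(diag(g) Fhat) <= 1].  A nonnegative matrix [A] has,
    for every [t > rho(A)], a positive vector [y] with [A y < t y]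
    ([spectral_radius_lt_supersolution]).  Applied to [A = diag(g) Fhat] and
    [t = 1 + d], this gives [g_i (Fhat y)_i / y_i < 1 + d], so
    [sum_i w_i ln g_i <= ln (1 + d) - phi(y) <= d - phi(x)], and [d] is
    arbitrary ([weighted_log_le]). *)

(** * Spectral radius and positive strict supersolutions *)

Section Spectral.
Variables (R : realType) (L : nat).
Implicit Types (A B : 'M[R]_L) (x y u : 'cV[R]_L) (t r : R).

Definition nonneg_mx A := forall i j, 0 <= A i j.

(** Strictness lets the set of admissible [t] be open, which is how its infimum
    is shown to be an eigenvalue. *)
Definition supersolution A t x :=
  pos_vec x /\ forall i, (A *m x) i 0 < t * x i 0.

Lemma normc_sum (I : finType) (f : I -> R[i]) :
  ComplexField.Normc.normc (\sum_i f i) <=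
  \sum_i ComplexField.Normc.normc (f i).
Proof.
elim/big_ind2: _ => [|a b c d ab cd|//].
  by rewrite ComplexField.Normc.normc0.
exact: le_trans (le_normcD _ _) (lerD ab cd).
Qed.

Lemma normc_real (a : R) :
  ComplexField.Normc.normc (real_complex R a) = `|a|.
Proof. by rewrite /= expr0n /= addr0 sqrtr_sqr. Qed.

Lemma normc_ge0 (z : R[i]) : 0 <= ComplexField.Normc.normc z.
Proof. by case: z => a b /=; rewrite sqrtr_ge0. Qed.

(** Weighting the moduli of a complex left eigenvector by the positive vector
    [x] turns the triangle inequality into [|z| S <= t S] with [S > 0]. *)
Lemma eigenvalue_normc_le A x t (z : R[i]) : nonneg_mx A -> pos_vec x ->
  (forall i, (A *m x) i 0 <= t * x i 0) ->
  eigenvalue (map_mx (real_complex R) A) z ->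
  ComplexField.Normc.normc z <= t.
Proof.
move=> A0 x0 Axt /eigenvalueP [v vA v0].
pose n := @ComplexField.Normc.normc R.
pose S := \sum_j n (v 0 j) * x j 0.
have S0 : 0 < S.
  have [j vj] : exists j, v 0 j != 0.
    apply/existsP; apply: contraNT v0; rewrite negb_exists => /forallP v0.
    apply/eqP/rowP => j; rewrite mxE; apply/eqP.
    by have := v0 j; rewrite negbK.
  rewrite /S (bigD1 j) //=; apply: ltr_pwDl.
    rewrite mulr_gt0 // lt_neqAle normc_ge0 andbT eq_sym.
    by apply: contra vj => /eqP /ComplexField.Normc.eq0_normc ->.
  by apply: sumr_ge0 => k _; rewrite mulr_ge0 ?normc_ge0 // ltW.
rewrite -(ler_pM2r S0) /S !mulr_sumr.
apply: (@le_trans _ _ (\sum_j \sum_i n (v 0 i) * A i j * x j 0)).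
  apply: ler_sum => j _; rewrite mulrA -mulr_suml ler_pM2r //.
  rewrite -ComplexField.Normc.normcM.
  have -> : z * v 0 j = (v *m map_mx (real_complex R) A) 0 j by rewrite vA mxE.
  rewrite mxE; apply: le_trans (normc_sum _) _.
  apply: ler_sum => i _; rewrite ComplexField.Normc.normcM mxE normc_real.
  by rewrite ger0_norm.
rewrite exchange_big /=; apply: ler_sum => i _.
have := Axt i; rewrite mxE => Axi.
rewrite mulrCA; under eq_bigr do rewrite -mulrA.
by rewrite -mulr_sumr ler_wpM2l // normc_ge0.
Qed.

Lemma exists_supersolution A : nonneg_mx A ->
  supersolution A (1 + \sum_i \sum_j A i j) (const_mx 1).
Proof.
move=> A0; split=> [l|i]; first by rewrite mxE ltr01.
rewrite !mxE mulr1; under eq_bigr do rewrite mxE mulr1.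
rewrite [in X in _ < X](bigD1 i) //= addrCA ltrDl ltr_pwDl //.
by apply: sumr_ge0 => k _; apply: sumr_ge0.
Qed.

(** This makes the supremum defining the spectral radius a genuine upper bound
    of the moduli. *)
Lemma spectral_radius_has_ubound A : nonneg_mx A ->
  has_ubound [set ComplexField.Normc.normc z | z in
        [set z : R[i] | eigenvalue (map_mx (real_complex R) A) z]].
Proof.
move=> A0; have [x0 xA] := exists_supersolution A0.
exists (1 + \sum_i \sum_j A i j) => _ [z /= zA <-].
by apply: (eigenvalue_normc_le A0 x0 _ zA) => i; apply: ltW.
Qed.

Lemma eigenvalue_real_complex A r : eigenvalue A r ->
  eigenvalue (map_mx (real_complex R) A) (real_complex R r).
Proof.
move=> /eigenvalueP [v vA v0].
apply/eigenvalueP; exists (map_mx (real_complex R) v).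
  by rewrite -map_mxM vA map_mxZ.
by rewrite map_mx_eq0.
Qed.

Lemma eigenvalue_le_spectral_radius A r : nonneg_mx A -> eigenvalue A r ->
  r <= spectral_radius A.
Proof.
move=> A0 rA; apply: (le_trans (ler_norm r)); rewrite -normc_real.
apply: ub_le_sup; first exact: spectral_radius_has_ubound.
by exists (real_complex R r) => //=; apply: eigenvalue_real_complex.
Qed.

Lemma spectral_radius_perron A x r : nonneg_mx A -> pos_vec x ->
  A *m x = r *: x -> eigenvalue A r -> spectral_radius A = r.
Proof.
move=> A0 x0 Ax rA; apply/le_anti/andP; split; last first.
  exact: eigenvalue_le_spectral_radius.
apply: ge_sup.
  exists (ComplexField.Normc.normc (real_complex R r)), (real_complex R r) => //=.
  exact: eigenvalue_real_complex.
move=> _ [z /= zA <-].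
by apply: (eigenvalue_normc_le A0 x0 _ zA) => i; rewrite Ax mxE.
Qed.

(** At an index [i] minimizing [u_i / x_i = q], the vector [u - q x] is
    nonnegative and vanishes; if [q < 0], comparing there [t u - A u >= 0] with
    [t x - A x > 0] is contradictory. *)
Lemma supersolution_max_principle A t x u : nonneg_mx A ->
  supersolution A t x -> (forall i, (A *m u) i 0 <= t * u i 0) ->
  forall i, 0 <= u i 0.
Proof.
move=> A0 [x0 xA] uA i0.
pose q i := u i 0 / x i 0.
have [i _ qmin] := arg_minP q (isT : xpredT i0).
suff qi0 : 0 <= q i.
  have := le_trans qi0 (qmin i0 isT); rewrite /q.
  by rewrite pmulr_lge0 // invr_gt0.
rewrite leNgt; apply/negP => qi0.
have uq j : q i * x j 0 <= u j 0 by rewrite -ler_pdivlMr //; apply: qmin.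
have : q i * (A *m x) i 0 <= (A *m u) i 0.
  rewrite !mxE mulr_sumr; apply: ler_sum => j _.
  by rewrite mulrCA ler_wpM2l.
move=> /le_trans /(_ (uA i)); apply/negP; rewrite -ltNge.
have -> : u i 0 = q i * x i 0 by rewrite /q divfK // gt_eqF.
by rewrite mulrCA ltr_nM2l.
Qed.

(** The maximum principle applies to a kernel vector and to its opposite. *)
Lemma unitmx_of_supersolution A t x : nonneg_mx A -> supersolution A t x ->
  t%:M - A \in unitmx.
Proof.
move=> A0 xA; apply: contraT => nu.
have /eigenvalueP [v vA v0] : eigenvalue A^T t.
  rewrite /eigenvalue /eigenspace kermx_eq0 row_free_unit -unitmx_tr.
  rewrite linearB /= trmxK tr_scalar_mx; apply: contra nu.
  rewrite -[A - _]opprB -scaleN1r.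
  by rewrite unitmxZ ?unitrN1.
have Av : A *m v^T = t *: v^T by rewrite -[A]trmxK -trmx_mul vA linearZ.
have v1 : forall i, 0 <= v^T i 0.
  by apply: (supersolution_max_principle A0 xA) => i; rewrite Av mxE.
have v2 : forall i, 0 <= (- v^T) i 0.
  apply: (supersolution_max_principle A0 xA) => i.
  by rewrite mulmxN Av !mxE mulrN.
case/eqP: v0; apply/rowP => j; rewrite mxE; apply/le_anti.
by have := v1 j; have := v2 j; rewrite !mxE oppr_ge0 => -> ->.
Qed.

(** Let [r] be the infimum of the [t] that admit a strict supersolution.  It is
    enough that [r] is an eigenvalue, since then [r <= rho(A) < t].  Otherwise
    [r - A] has an inverse [N], and for admissible [t'] close to [r] the vector
    [u = (t' - A)^-1 1] is positive and is bounded in terms of [N] alone, by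
    the resolvent identity [u = N (1 - (t' - r) u)].  Then
    [A u = t' u - 1 < (t' - s) u] for a fixed [s > 0], so [t' - s] is
    admissible as well, although it is less than [r]. *)
Lemma spectral_radius_lt_supersolution A t : (0 < L)%N -> nonneg_mx A ->
  spectral_radius A < t -> exists x, supersolution A t x.
Proof.
move=> L0 A0 rt; pose i0 := Ordinal L0.
pose T := [set s | exists x, supersolution A s x].
have Tlb s : T s -> 0 < s.
  case=> x [x0 /(_ i0)].
  have /le_lt_trans h : 0 <= (A *m x) i0 0.
    by rewrite mxE; apply: sumr_ge0 => j _; rewrite mulr_ge0 // ltW.
  by move=> /h; rewrite pmulr_lgt0.
have Tinf : has_inf T.
  split; last by exists 0 => s /Tlb /ltW.
  by exists (1 + \sum_i \sum_j A i j), (const_mx 1); apply: exists_supersolution.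
have [_ Tlbd] := Tinf.
set r := inf T.
suff r_eig : eigenvalue A r.
  have rho_r := eigenvalue_le_spectral_radius A0 r_eig.
  have tr : 0 < t - r by rewrite subr_gt0 (le_lt_trans rho_r).
  have [s [x [x0 xA]]] := inf_adherent tr Tinf.
  rewrite addrC subrK => st; exists x; split => // i.
  by apply: (lt_trans (xA i)); rewrite ltr_pM2r.
apply: contraT => r_neig.
have r_unit : r%:M - A \in unitmx.
  rewrite -[_ - A]opprB -scaleN1r unitmxZ ?unitrN1 //.
  move: r_neig; rewrite /eigenvalue /eigenspace kermx_eq0 row_free_unit.
  by rewrite negbK.
pose N := invmx (r%:M - A).
(* C bounds N, the sum S of the entries of u will be at most 2 C, and 1 / (4 C)
   serves both as the distance of t' to r and as the decrement s. *)
pose C := 1 + \sum_i \sum_j `|N i j|.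
have C0 : 0 < C.
  by rewrite /C ltr_pwDl //; apply: sumr_ge0 => i _; apply: sumr_ge0.
have C40 : 0 < (4 * C)^-1 by rewrite invr_gt0 mulr_gt0.
have [t' [x xA]] := inf_adherent C40 Tinf; rewrite -/r => t'r.
have Tt' : T t' by exists x.
have rt' : r <= t' by apply: ge_inf.
pose u : 'cV[R]_L := invmx (t'%:M - A) *m const_mx 1.
have uE : (t'%:M - A) *m u = const_mx 1.
  by rewrite mulKVmx // (unitmx_of_supersolution A0 xA).
have Au i : (A *m u) i 0 = t' * u i 0 - 1.
  have := congr1 (fun M : 'cV_L => M i 0) uE.
  by rewrite mulmxBl mul_scalar_mx !mxE; lra.
have u0 : forall i, 0 <= u i 0.
  by apply: (supersolution_max_principle A0 xA) => i; rewrite Au; lra.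
have upos : pos_vec u.
  move=> i; have : 1 <= t' * u i 0.
    have : 0 <= (A *m u) i 0.
      by rewrite mxE; apply: sumr_ge0 => j _; rewrite mulr_ge0.
    by rewrite Au; lra.
  by move/(lt_le_trans ltr01); rewrite pmulr_rgt0 // Tlb.
pose S := \sum_i u i 0.
have uN i : u i 0 = \sum_j N i j * (1 - (t' - r) * u j 0).
  have : (r%:M - A) *m u = \col_j (1 - (t' - r) * u j 0).
    apply/colP => j; rewrite mulmxBl mul_scalar_mx !mxE.
    by have := Au j; rewrite !mxE => ->; lra.
  move=> /(congr1 (mulmx N)); rewrite mulKmx // => /colP /(_ i) ->.
  by rewrite mxE; apply: eq_bigr => j _; rewrite mxE.
have uS i : u i 0 <= S.
  by rewrite /S (bigD1 i) //= lerDl; apply: sumr_ge0.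
have S0 : 0 <= S by apply: sumr_ge0.
have SC : S <= C * (1 + (t' - r) * S).
  apply: (@le_trans _ _ (\sum_i \sum_j `|N i j| * (1 + (t' - r) * S))).
    apply: ler_sum => i _; rewrite uN; apply: ler_sum => j _.
    apply: (le_trans (ler_norm _)); rewrite normrM ler_wpM2l //.
    have h1 : 0 <= (t' - r) * u j 0 by rewrite mulr_ge0 // subr_ge0.
    have h2 : (t' - r) * u j 0 <= (t' - r) * S by rewrite ler_wpM2l // subr_ge0.
    by rewrite ler_norml; apply/andP; split; lra.
  under eq_bigr do rewrite -mulr_suml.
  rewrite -mulr_suml ler_wpM2r //; last by rewrite /C; lra.
  by rewrite addr_ge0 // mulr_ge0 // subr_ge0.
have tC : (t' - r) * C <= 4^-1.
  have : t' - r <= (4 * C)^-1 by lra.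
  by rewrite invfM ler_pdivlMr.
have S2 : S <= 2 * C.
  have : C * (t' - r) * S <= 4^-1 * S by rewrite ler_wpM2r // mulrC.
  by move: SC; rewrite mulrDr mulr1 mulrA; lra.
have : T (t' - (4 * C)^-1).
  exists u; split => // i; rewrite Au mulrBl ltrD2l ltrN2.
  rewrite mulrC ltr_pdivrMr ?mulr_gt0 // mul1r.
  by apply: le_lt_trans (le_trans (uS i) S2) _; lra.
move/(ge_inf Tlbd); rewrite -/r => ?.
by exfalso; lra.
Qed.

End Spectral.

(** * Uniqueness of positive eigenvectors *)

Section PositiveEigenvectors.
Variables (R : realType) (L : nat).
Implicit Types (A : 'M[R]_L) (x y : 'cV[R]_L) (r : R).

(** Subtract from [y] the largest multiple of [x] that leaves a nonnegative
    vector [u].  Then [u] is an eigenvector with a zero entry [u_i], and row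
    [i] of the eigenvector equation, whose off-diagonal coefficients are
    positive, forces all other entries to vanish. *)
Lemma pos_eigenvector_unique A r x y : (0 < L)%N ->
  (forall i j, i != j -> 0 < A i j) -> pos_vec x -> pos_vec y ->
  A *m x = r *: x -> A *m y = r *: y -> exists a, y = a *: x.
Proof.
move=> L0 Aoff x0 y0 Ax Ay; pose i0 := Ordinal L0.
pose q i := y i 0 / x i 0.
have [i _ qmin] := arg_minP q (isT : xpredT i0).
exists (q i); pose u := y - q i *: x.
have u0 j : 0 <= u j 0.
  by rewrite !mxE subr_ge0 -ler_pdivlMr //; apply: qmin.
have ui : u i 0 = 0 by rewrite !mxE /q divfK ?subrr // gt_eqF.
have : (A *m u) i 0 = 0.
  by rewrite mulmxBr -scalemxAr Ax Ay scalerA mulrC -scalerA -scalerBr mxE ui mulr0.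
rewrite mxE (bigD1 i) //= ui mulr0 add0r => /eqP.
rewrite psumr_eq0; last first.
  by move=> j ji; rewrite mulr_ge0 // ltW // Aoff // eq_sym.
move=> /allP Au; apply/eqP; rewrite -subr_eq0; apply/eqP/colP => j.
rewrite -/u [RHS]mxE; have [->//|ji] := eqVneq j i.
have := Au j (mem_index_enum j); rewrite ji /= mulf_eq0 gt_eqF /=.
  by move/eqP.
by apply: Aoff; rewrite eq_sym.
Qed.

(** Another Perron pair is [(a x, b y)] by uniqueness, and the normalization
    of both products gives [a b = 1]. *)
Lemma perron_product_of_pair A x y : (0 < L)%N ->
  (forall i j, i != j -> 0 < A i j) -> perron_pair A x y ->
  perron_product A (hadamard x y).
Proof.
move=> L0 Aoff xyA; split; first by exists x, y.
move=> x' y' [x'0 y'0 Ax' yA' [_ s']]; have [x0 y0 Ax yA [_ s]] := xyA.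
have [a xE] := pos_eigenvector_unique L0 Aoff x0 x'0 Ax Ax'.
have tr_eig (z : 'cV_L) : z^T *m A = spectral_radius A *: z^T ->
    A^T *m z = spectral_radius A *: z.
  by move/(congr1 trmx); rewrite trmx_mul !linearZ /= trmxK.
have [b yE] : exists b, y' = b *: y.
  have Atoff i j : i != j -> 0 < A^T i j.
    by move=> ij; rewrite mxE Aoff // eq_sym.
  exact: (pos_eigenvector_unique L0 Atoff y0 y'0 (tr_eig _ yA) (tr_eig _ yA')).
have hE : hadamard x' y' = (a * b) *: hadamard x y.
  by apply/colP => i; rewrite xE yE !mxE mulrACA.
suff ab : a * b = 1 by rewrite hE ab scale1r.
move: s'; rewrite hE; under eq_bigr do rewrite mxE.
by rewrite -mulr_sumr s mulr1.
Qed.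

End PositiveEigenvectors.

(** * Minimization of the mean logarithmic ratio *)

Section Preliminaries.
Variable R : realType.

Lemma finite_pos_lb (I : finType) (P : pred I) (f : I -> R) :
  (forall i, P i -> 0 < f i) -> exists2 c, 0 < c & forall i, P i -> c <= f i.
Proof.
move=> f0; exists (\big[Order.min/1]_(i | P i) f i).
  by apply: lt_bigmin.
by move=> i Pi; apply: bigmin_le_cond.
Qed.

Lemma continuous_at_sum (T : topologicalType) (I : finType) (f : I -> T -> R)
    (v : T) : (forall i, {for v, continuous (f i)}) ->
  {for v, continuous (fun u => \sum_i f i u)}.
Proof.
by move=> fv; apply: cvg_big => [|i _]; [exact: add_continuous|exact: fv].
Qed.

Lemma ln_sub_le (a b : R) : 0 < a -> 0 < b -> ln b - ln a <= (b - a) / a.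
Proof.
move=> a0 b0; rewrite -ln_div ?posrE // mulrBl divff ?gt_eqF //.
have := @le_ln1Dx R (b / a - 1); rewrite [1 + _]addrC subrK; apply.
by rewrite ltrBrDl subrr divr_gt0.
Qed.

End Preliminaries.

Section MeanLogRatio.
Variables (R : realType) (L : nat).
Variables (F : 'M[R]_L) (w : 'cV[R]_L).
Hypothesis F0 : nonneg_mx F.
Hypothesis Foff : forall i j, i != j -> 0 < F i j.
Hypothesis w0 : pos_vec w.
Hypothesis w1 : \sum_l w l 0 = 1.
Hypothesis wC : forall l, w l 0 < \sum_(j | j != l) w j 0.
Implicit Types x : 'cV[R]_L.

Definition mean_log_ratio x := \sum_i w i 0 * ln ((F *m x) i 0 / x i 0).

Lemma exists_neq (i : 'I_L) : exists j, j != i.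
Proof.
apply/existsP; apply: contraT; rewrite negb_exists => /forallP h.
have := wC i; rewrite big_pred0 ?ltNge ?(ltW (w0 i)) //.
by move=> j; apply/negbTE/h.
Qed.

Lemma mulmx_entry_ge x i j : pos_vec x -> F i j * x j 0 <= (F *m x) i 0.
Proof.
move=> x0; rewrite mxE (bigD1 j) //= lerDl.
by apply: sumr_ge0 => k _; rewrite mulr_ge0 // ltW.
Qed.

Lemma mulmx_pos x : pos_vec x -> pos_vec (F *m x).
Proof.
move=> x0 i; have [j ji] := exists_neq i.
apply: lt_le_trans (mulmx_entry_ge i j x0).
by rewrite mulr_gt0 // Foff // eq_sym.
Qed.

Lemma ratio_pos x i : pos_vec x -> 0 < (F *m x) i 0 / x i 0.
Proof. by move=> x0; rewrite divr_gt0 // mulmx_pos. Qed.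

Lemma mean_log_ratioZ a x : 0 < a ->
  mean_log_ratio (a *: x) = mean_log_ratio x.
Proof.
move=> a0; apply: eq_bigr => i _.
by rewrite -scalemxAr !mxE -mulf_div divff ?mul1r // gt_eqF.
Qed.

(** Write [phi] for the mean logarithmic ratio, let [x_k = 1] and
    [t_i = - ln x_i >= 0], and let [t_m] be the smallest [t_j] with [j != k].  Up to the constant [ln c], where [c] bounds the
    off-diagonal entries from below, [ln (F x)_i] is at least 0 for [i != k]
    and at least [- t_m] for [i = k].  Hence [phi(x) - ln c] is at least
    [sum_(j != k) w_j t_j - w_k t_m], that is,
    [sum_(j != k) w_j (t_j - t_m) + (sum_(j != k) w_j - w_k) t_m]: both parts
    are nonnegative with positive coefficients, and together they control
    [t_i = (t_i - t_m) + t_m] for each [i != k], while [t_k = 0]. *)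
Lemma mean_log_ratio_coercive : exists c e : R, 0 < e /\
  forall x, pos_vec x -> (forall i, x i 0 <= 1) -> (exists k, x k 0 = 1) ->
   forall i, c - e * ln (x i 0) <= mean_log_ratio x.
Proof.
have [c c0 cF] : exists2 c, 0 < c & forall i j, i != j -> c <= F i j.
  have [|c c0 cF] := @finite_pos_lb R _ (fun p : 'I_L * 'I_L => p.1 != p.2)
    (fun p => F p.1 p.2); first by case=> i j; apply: Foff.
  by exists c => // i j ij; apply: (cF (i, j)).
have [e1 e10 e1w] := @finite_pos_lb R _ xpredT (fun i => w i 0) (fun i _ => w0 i).
have [|e2 e20 e2w] := @finite_pos_lb R _ xpredT
  (fun k => \sum_(j | j != k) w j 0 - w k 0).
  by move=> k _; rewrite subr_gt0.
exists (ln c), (Num.min e1 e2); split; first by rewrite lt_min e10.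
move=> x x0 x1 [k xk] i.
pose e := Num.min e1 e2; rewrite -/e.
have [j0 j0k] := exists_neq k.
have [m mk mmax] :=
  @arg_maxP _ _ _ j0 (fun j => j != k) (fun j => x j 0) j0k.
pose t j := - ln (x j 0).
have t0 j : 0 <= t j by rewrite oppr_ge0 ln_le0.
have lnx j : ln ((F *m x) j 0 / x j 0) = ln ((F *m x) j 0) + t j.
  by rewrite ln_div ?posrE ?mulmx_pos.
have lnF j l : j != l -> ln c - t l <= ln ((F *m x) j 0).
  move=> jl; rewrite opprK -lnM ?posrE // ler_ln ?posrE ?mulr_gt0 ?mulmx_pos //.
  apply: le_trans (mulmx_entry_ge j l x0); rewrite ler_wpM2r ?cF //.
  exact: ltW.
have tk : t k = 0 by rewrite /t xk ln1 oppr0.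
have tm j : j != k -> t m <= t j.
  by move=> jk; rewrite lerN2 ler_ln ?posrE //; apply: mmax.
have lower : ln c - w k 0 * t m + \sum_(j | j != k) w j 0 * t j
   <= mean_log_ratio x.
  rewrite /mean_log_ratio [leRHS](bigD1 k) //= lnx tk addr0.
  have -> : ln c = w k 0 * ln c + \sum_(j | j != k) w j 0 * ln c.
    rewrite -mulr_suml -mulrDl -{1}[ln c]mul1r; congr (_ * _).
    by rewrite -w1 (bigD1 k).
  rewrite [_ + _ - _]addrAC -mulrBr -addrA -big_split /=; apply: lerD.
    by rewrite ler_pM2l // lnF // eq_sym.
  apply: ler_sum => j jk; rewrite lnx -mulrDr ler_pM2l // lerD2r.
  by have := lnF j k jk; rewrite tk subr0.
apply: le_trans lower; rewrite -mulrN -/(t i) -addrA lerD2l.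
have sumE : \sum_(j | j != k) w j 0 * t j
    = \sum_(j | j != k) w j 0 * (t j - t m) + (\sum_(j | j != k) w j 0) * t m.
  rewrite mulr_suml -big_split /=; apply: eq_bigr => j _.
  by rewrite mulrBr subrK.
rewrite sumE addrC -addrA -mulrBl.
have d0 : e * t m <= (\sum_(j | j != k) w j 0 - w k 0) * t m.
  by rewrite ler_wpM2r // ge_min e2w ?orbT.
have d1 : e * (t i - t m) <= \sum_(j | j != k) w j 0 * (t j - t m).
  have pos j : j != k -> 0 <= w j 0 * (t j - t m).
    by move=> jk; rewrite mulr_ge0 ?subr_ge0 ?tm // ltW.
  have [->|ik] := eqVneq i k.
    apply: (@le_trans _ _ 0); last exact: sumr_ge0.
    rewrite tk sub0r pmulr_rle0 ?oppr_le0 //.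
    by rewrite lt_min e10.
  rewrite (bigD1 i) //=; apply: ler_wpDr.
    by apply: sumr_ge0 => j /andP [jk _]; apply: pos.
  by rewrite ler_wpM2r ?subr_ge0 ?tm // ge_min e1w.
by move: d0 d1; rewrite mulrBr; lra.
Qed.

Lemma mean_log_ratio_continuous (v : 'rV[R]_L) : pos_vec v^T ->
  {for v, continuous (fun v : 'rV[R]_L => mean_log_ratio v^T)}.
Proof.
move=> v0; rewrite /mean_log_ratio.
have coord j : {for v, continuous (fun v : 'rV[R]_L => v^T j 0)}.
  rewrite (_ : (fun v : 'rV[R]_L => v^T j 0) = fun v => v 0 j).
    exact: coord_continuous.
  by apply/funext => u; rewrite mxE.
apply: (continuous_at_sum (T := 'rV[R]_L)) => i.
apply: continuousM; first exact: cst_continuous.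
apply: (@continuous_comp _ _ _ (fun v : 'rV[R]_L => (F *m v^T) i 0 / v^T i 0)
  (@ln R)); last by apply: continuous_ln; apply: ratio_pos.
apply: continuousM; last first.
  by apply: continuousV; [rewrite gt_eqF|apply: coord].
rewrite (_ : (fun v : 'rV[R]_L => (F *m v^T) i 0) =
  fun v => \sum_j F i j * v^T j 0); last by apply/funext => u; rewrite mxE.
apply: (continuous_at_sum (T := 'rV[R]_L)) => j.
by apply: continuousM; [exact: cst_continuous|apply: coord].
Qed.

(** By scale invariance only vectors with largest entry 1 matter.  Coercivity
    gives [b > 0] such that such a vector with an entry below [b] has a larger
    value than the all-ones vector, so that a minimum over the compact box
    [[b, 1]^L] is global. *)
Lemma mean_log_ratio_has_min : (0 < L)%N -> exists2 x, pos_vec x &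
  forall y, pos_vec y -> mean_log_ratio x <= mean_log_ratio y.
Proof.
move=> L0; pose i0 := Ordinal L0.
have [c [e [e0 coer]]] := mean_log_ratio_coercive.
pose one : 'cV[R]_L := const_mx 1.
have one0 : pos_vec one by move=> i; rewrite mxE ltr01.
have cone : c <= mean_log_ratio one.
  have := coer one one0 _ _ i0; rewrite mxE ln1 mulr0 subr0; apply.
    by move=> i; rewrite mxE.
  by exists i0; rewrite mxE.
pose b := expR (- ((mean_log_ratio one - c) / e)).
have b0 : 0 < b by apply: expR_gt0.
have b1 : b <= 1.
  by rewrite /b -expR0 ler_expR oppr_le0 divr_ge0 ?subr_ge0 // ltW.
pose K := [set v : 'rV[R]_L | forall i, `[b, 1]%classic (v ord0 i)].
have Kpos v : K v -> pos_vec v^T.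
  move=> Kv i; rewrite mxE; have /= := Kv i.
  by rewrite in_itv /= => /andP [/(lt_le_trans b0)].
have Kcpt : compact K.
  by apply: (@rV_compact _ L (fun=> `[b, 1]%classic)) => _; exact: segment_compact.
have Kone : K one^T by move=> i; rewrite /= !mxE in_itv /= b1 lexx.
have [|x] := EVT_min_rV (f := fun v => mean_log_ratio v^T)
   (ex_intro _ _ Kone) Kcpt.
  apply: continuous_in_subspaceT => v /set_mem /Kpos.
  exact: mean_log_ratio_continuous.
move=> /set_mem Kx xmin; exists x^T; first exact: Kpos.
move=> y y0.
have [k _ kmax] := arg_maxP (fun j => y j 0) (isT : xpredT i0).
pose z := (y k 0)^-1 *: y.
have zE i : z i 0 = y i 0 / y k 0 by rewrite mxE mulrC.
have z0 : pos_vec z by move=> i; rewrite zE divr_gt0.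
have z1 i : z i 0 <= 1 by rewrite zE ler_pdivrMr // mul1r; apply: kmax.
have zk : z k 0 = 1 by rewrite zE divff // gt_eqF.
rewrite -(@mean_log_ratioZ (y k 0)^-1 y) ?invr_gt0 // -/z.
have [zK|] := pselect (K z^T).
  by have := xmin _ (mem_set zK); rewrite trmxK.
have xone : mean_log_ratio x^T <= mean_log_ratio one.
  by have := xmin _ (mem_set Kone); rewrite trmxK.
move=> /existsNP [l]; rewrite /= mxE in_itv /= z1 andbT => /negP.
rewrite -ltNge => zb; apply: (le_trans xone).
apply: le_trans (coer z z0 z1 (ex_intro _ _ zk) l).
have : ln (z l 0) <= ln b by rewrite ler_ln ?posrE // ltW.
rewrite /b expRK => h.
have : e * ln (z l 0) <= e * - ((mean_log_ratio one - c) / e).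
  by rewrite ler_pM2l.
rewrite mulrN mulrC [X in - X]mulrC divfK ?gt_eqF //.
lra.
Qed.

(** Minimality along the line [x + h e_j], combined with the concavity estimate
    [ln b - ln a <= (b - a) / a] in each logarithm, gives
    [0 <= h (S - w_j / (x_j + h))] for all small [h] of either sign, where [S]
    is the sum in the statement; [h -> 0] from both sides yields
    [S = w_j / x_j]. *)
Lemma mean_log_ratio_stationary x : pos_vec x ->
  (forall y, pos_vec y -> mean_log_ratio x <= mean_log_ratio y) ->
  forall j, (\sum_i w i 0 / (F *m x) i 0 * F i j) * x j 0 = w j 0.
Proof.
move=> x0 xmin j; set S := \sum_i _.
have key h : 0 < x j 0 + h -> 0 <= h * (S - w j 0 / (x j 0 + h)).
  move=> h0; pose y := x + h *: delta_mx j 0.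
  have yE i : y i 0 = x i 0 + h * (i == j)%:R by rewrite !mxE eqxx andbT.
  have y0 : pos_vec y.
    by move=> i; rewrite yE; case: eqVneq => [->|_]; rewrite ?mulr1 ?mulr0 ?addr0.
  have FyE i : (F *m y) i 0 = (F *m x) i 0 + h * F i j.
    by rewrite mulmxDr -scalemxAr -colE !mxE.
  have lnE z i : pos_vec z ->
      ln ((F *m z) i 0 / z i 0) = ln ((F *m z) i 0) - ln (z i 0).
    by move=> z0; rewrite ln_div ?posrE ?mulmx_pos.
  have := xmin y y0; rewrite -subr_ge0 -sumrB => /le_trans; apply.
  apply: (@le_trans _ _ (\sum_i (h * (w i 0 / (F *m x) i 0 * F i j)
     - w i 0 * (ln (y i 0) - ln (x i 0))))).
    apply: ler_sum => i _; rewrite !lnE //.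
    have := ln_sub_le (mulmx_pos x0 i) (mulmx_pos y0 i).
    rewrite FyE addrAC subrr add0r => /(ler_wpM2l (ltW (w0 i))).
    have -> : w i 0 * (h * F i j / (F *m x) i 0) =
        h * (w i 0 / (F *m x) i 0 * F i j) by ring.
    lra.
  rewrite sumrB -mulr_sumr -/S mulrBr lerD2l lerN2.
  rewrite (bigD1 j) //= big1 ?addr0; last first.
    by move=> i /negbTE ij; rewrite yE ij mulr0 addr0 subrr mulr0.
  have := ln_sub_le (y0 j) (x0 j).
  rewrite yE eqxx mulr1 opprD addrA subrr add0r => /(ler_wpM2l (ltW (w0 j))).
  have -> : w j 0 * (- h / (x j 0 + h)) = - (h * (w j 0 / (x j 0 + h))) by ring.
  lra.
have up h : 0 < h -> w j 0 <= S * (x j 0 + h).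
  move=> h0; have xh : 0 < x j 0 + h by rewrite addr_gt0.
  by have := key h xh; rewrite pmulr_rge0 // subr_ge0 ler_pdivrMr.
have dn h : 0 < h -> h < x j 0 -> S * (x j 0 - h) <= w j 0.
  move=> h0 hx; have xh : 0 < x j 0 - h by rewrite subr_gt0.
  have := key (- h) xh; rewrite mulNr oppr_ge0 pmulr_rle0 //.
  by rewrite subr_le0 ler_pdivlMr.
have S0 : 0 < S.
  have := up 1 ltr01; move=> /(lt_le_trans (w0 j)).
  by rewrite pmulr_lgt0 // addr_gt0.
apply/le_anti/andP; split; apply/ler_addgt0Pr => d d0.
  pose h := Num.min (d / S) (x j 0 / 2).
  have h0 : 0 < h by rewrite lt_min !divr_gt0.
  have hx : h < x j 0.
    by rewrite gt_min; apply/orP; right; rewrite ltr_pdivrMr // ltr_pMr // ltr1n.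
  have hd : h * S <= d by rewrite -ler_pdivlMr // ge_min lexx.
  by have := dn h h0 hx; rewrite mulrBr mulrC; lra.
have := up (d / S) (divr_gt0 d0 S0).
by rewrite mulrDr [S * (d / S)]mulrC divfK ?gt_eqF.
Qed.

End MeanLogRatio.

(** * The optimal scaling *)

Section OptimalScaling.
Variables (R : realType) (L : nat).
Variables (F : 'M[R]_L) (w : 'cV[R]_L).
Hypothesis F0 : nonneg_mx F.
Hypothesis Foff : forall i j, i != j -> 0 < F i j.
Hypothesis w0 : pos_vec w.
Hypothesis w1 : \sum_l w l 0 = 1.
Hypothesis wC : forall l, w l 0 < \sum_(j | j != l) w j 0.
Hypothesis L0 : (0 < L)%N.

Lemma diag_scaleE (g : 'cV[R]_L) i j : diag_scale g F i j = g i 0 * F i j.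
Proof. by rewrite /diag_scale mul_diag_mx !mxE. Qed.

Lemma diag_scale_nonneg (g : 'cV[R]_L) : pos_vec g ->
  nonneg_mx (diag_scale g F).
Proof. by move=> g0 i j; rewrite diag_scaleE mulr_ge0 // ltW. Qed.

Lemma diag_scale_mulmx (g x : 'cV[R]_L) i :
  (diag_scale g F *m x) i 0 = g i 0 * (F *m x) i 0.
Proof. by rewrite -mulmxA mul_diag_mx !mxE. Qed.

(** The entrywise product of [x] with [y = w / x] is [w], and stationarity is
    the left eigenvector equation for [y].  A positive eigenvector makes its
    eigenvalue 1 the spectral radius. *)
Lemma scaled_perron (x : 'cV[R]_L) : pos_vec x ->
  (forall j, (\sum_i w i 0 / (F *m x) i 0 * F i j) * x j 0 = w j 0) ->
  let g := \col_i (x i 0 / (F *m x) i 0) in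
  [/\ pos_vec g, spectral_radius (diag_scale g F) = 1 &
      perron_product (diag_scale g F) w].
Proof.
move=> x0 xstat g; have Fx0 := mulmx_pos F0 Foff w0 wC x0.
have g0 : pos_vec g by move=> i; rewrite mxE divr_gt0.
have A0 := diag_scale_nonneg g0.
have Ax : diag_scale g F *m x = 1 *: x.
  apply/colP => i; rewrite diag_scale_mulmx [g i 0]mxE scale1r.
  by rewrite divfK // gt_eqF.
pose y : 'cV[R]_L := \col_i (w i 0 / x i 0).
have y0 : pos_vec y by move=> i; rewrite mxE divr_gt0.
have yA : y^T *m diag_scale g F = 1 *: y^T.
  apply/rowP => j; rewrite !mxE mul1r -xstat mulfK ?gt_eqF //.
  apply: eq_bigr => i _; rewrite mxE diag_scaleE !mxE mulrA; congr (_ * _).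
  by rewrite mulrA divfK ?gt_eqF.
have rho1 : spectral_radius (diag_scale g F) = 1.
  apply: (spectral_radius_perron A0 x0 Ax).
  apply/eigenvalueP; exists y^T => //.
  apply/eqP => /rowP /(_ (Ordinal L0)); rewrite mxE [RHS]mxE => /eqP.
  by rewrite gt_eqF.
have hw : hadamard x y = w.
  by apply/colP => i; rewrite !mxE mulrC divfK ?gt_eqF.
split => //; rewrite -[w in perron_product _ w]hw.
apply: perron_product_of_pair => //.
  by move=> i j ij; rewrite diag_scaleE mulr_gt0 // Foff.
split; rewrite ?rho1 // hw; split => // l; exact: ltW.
Qed.

(** A supersolution [y] of [diag(g) F] for [1 + d] is a competitor for the
    minimum and bounds every [g_i] by [(1 + d) y_i / (F y)_i]. *)
Lemma weighted_log_le (g x : 'cV[R]_L) : pos_vec g ->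
  spectral_radius (diag_scale g F) <= 1 ->
  (forall y, pos_vec y -> mean_log_ratio F w x <= mean_log_ratio F w y) ->
  weighted_log w g <= - mean_log_ratio F w x.
Proof.
move=> g0 rho1 xmin; apply/ler_addgt0Pr => d d0.
have rho_d : spectral_radius (diag_scale g F) < 1 + d.
  by apply: (le_lt_trans rho1); rewrite ltrDl.
have [y [y0 gy]] :=
  spectral_radius_lt_supersolution L0 (diag_scale_nonneg g0) rho_d.
have := xmin y y0; suff : weighted_log w g <= d - mean_log_ratio F w y by lra.
rewrite -[d]mul1r -w1 mulr_suml -sumrB; apply: ler_sum => i _.
rewrite -mulrBr ler_pM2l //.
have r0 : 0 < (F *m y) i 0 / y i 0 by apply: ratio_pos.
rewrite lerBrDr -lnM ?posrE //; apply: (@le_trans _ _ (ln (1 + d))).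
  rewrite ler_ln ?posrE ?(mulr_gt0 (g0 i) r0) ?addr_gt0 //.
  rewrite mulrA -diag_scale_mulmx ler_pdivrMr //; exact: ltW.
by apply: le_ln1Dx; lra.
Qed.

End OptimalScaling.

Theorem theorem4p6 (R : realType) (L : nat)
  (F : 'M[R]_L) (v pbar w : 'cV[R]_L) (Fhat : 'M[R]_L)
  (Fdiag : forall l, F l l = 0)
  (Foff : forall i j, i != j -> 0 < F i j)
  (v_pos : pos_vec v)
  (pbar_pos : pos_vec pbar)
  (w_pos : pos_vec w)
  (w_prob : prob_vec w)
  (w_cond : forall l, w l 0 < \sum_(j | j != l) w j 0)
  (FhatE : Fhat = F \/
     exists l, Fhat = F + (pbar l 0)^-1 *: (v *m (std_basis R l)^T)) :
  exists gstar : 'cV[R]_L,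
    [/\ pos_vec gstar,
        spectral_radius (diag_scale gstar Fhat) = 1,
        perron_product (diag_scale gstar Fhat) w &
        is_max [set weighted_log w g | g in
                  [set g | pos_vec g /\
                           spectral_radius (diag_scale g Fhat) <= 1]]
               (weighted_log w gstar)].
Proof.
have [_ w1] := w_prob.
have L0 : (0 < L)%N.
  have [//|Lle0] := ltnP 0 L; have/eqP := w1; rewrite big1 => [|i _].
    by rewrite eq_sym oner_eq0.
  by have := leq_trans (ltn_ord i) Lle0.
have F0 : nonneg_mx F.
  by move=> i j; have [->|/Foff/ltW//] := eqVneq i j; rewrite Fdiag.
(* Both forms of Fhat are nonnegative perturbations of F, hence nonnegative
   with positive off-diagonal entries. *)
have [E [E0 FhatD]] : exists E : 'M[R]_L, nonneg_mx E /\ Fhat = F + E.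
  case: FhatE => [->|[l ->]].
    by exists 0; split=> [i j|]; rewrite ?mxE ?addr0.
  exists ((pbar l 0)^-1 *: (v *m (std_basis R l)^T)); split=> // i j.
  rewrite !mxE big_ord1 !mxE mulr_ge0 ?invr_ge0 ?(ltW (pbar_pos l)) //.
  by rewrite mulr_ge0 ?ler0n // ltW.
have Fh0 : nonneg_mx Fhat.
  by move=> i j; rewrite FhatD mxE addr_ge0.
have Fhoff i j : i != j -> 0 < Fhat i j.
  by move=> ij; rewrite FhatD mxE ltr_wpDr // Foff.
have [x x0 xmin] := mean_log_ratio_has_min Fh0 Fhoff w_pos w1 w_cond L0.
have xstat := mean_log_ratio_stationary Fh0 Fhoff w_pos w_cond x0 xmin.
have [] := scaled_perron Fh0 Fhoff w_pos w1 w_cond L0 x0 xstat.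
set g := \col_i _ => g0 rho1 gw; exists g; split=> //.
have gE : weighted_log w g = - mean_log_ratio Fhat w x.
  rewrite /weighted_log -sumrN; apply: eq_bigr => i _.
  rewrite -mulrN -lnV ?posrE ?(ratio_pos Fh0 Fhoff w_pos w_cond) //.
  by rewrite [g i 0]mxE invf_div.
split; first by exists g => //=; rewrite rho1.
move=> _ [h [/= h0 hrho] <-]; rewrite gE.
exact: (weighted_log_le Fh0 Fhoff w_pos w1 w_cond L0).
Qed.
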